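(* Let $q=2^f$ with $f\ge 4$, let $q_0$ be a power of $2$ with $q_0<q$, and assume that $\gcd(q-1,q_0^2-1)=1$. Then: (i) for every $u\in\mathbb{F}_q$, the graph $\Gamma_u=\mathrm{Cay}(K,\Omega_u\cup\Omega_{u+1})$ is a connected Cayley graph; (ii) if, in addition, $u\in\mathscr{U}_{q,q_0}$, then $\mathrm{Aut}(\Gamma_u)=G$, i.e. the full automorphism group of $\Gamma_u$ is exactly the permutation group induced by $G$ on $K$; in particular $G$ has a graphical Frobenius representation on $\Gamma_u$.
   Context: For $a,c\in\mathbb{F}_q$ and $\lambda\in\mathbb{F}_q^*$ let $\Phi_{a,c}=\begin{bmatrix}1&0&0\\ a&1&0\\ c&a^{q_0}&1\end{bmatrix}$ and $\Psi_\lambda=\mathrm{diag}(1,\lambda,\lambda^{q_0+1})$. Let $K=\{\Phi_{a,c}: a,c\in\mathbb{F}_q\}$ (a group of order $q^2$), $H=\{\Psi_\lambda:\lambda\in\mathbb{F}_q^*\}$ (cyclic of order $q-1$, normalizing $K$), and $G=HK\le GL(3,\mathbb{F}_q)$. For $u\in\mathbb{F}_q$ let $\Omega_u=\{\Phi_{a,ua^{q_0+1}}: a\in\mathbb{F}_q^*\}$. The Cayley graph $\Gamma_u=\mathrm{Cay}(K,\Omega_u\cup\Omega_{u+1})$ has vertex set $K$, with $x,y$ adjacent iff $xy^{-1}\in\Omega_u\cup\Omega_{u+1}$ (this set is inverse-closed, and the graph is simple and undirected). $G$ acts on $K$: elements of $K$ act by right multiplication and $\Psi\in H$ acts by conjugation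 $x\mapsto \Psi^{-1}x\Psi$; $G$ is identified with this permutation group on $K$, which is a group of automorphisms of $\Gamma_u$ acting as a Frobenius group with kernel $K$ and point stabilizer $H$. A group has a graphical Frobenius representation on a graph if it is isomorphic to the full automorphism group of the graph and acts on the vertices as a Frobenius group. $\mathscr{U}_{q,q_0}$ is the set of $u\in\mathbb{F}_q$ such that (U1) $u=(1+\eta^{q_0})/(\eta+\eta^{q_0})$ for some primitive element $\eta$ of $\mathbb{F}_q$, and (U2) the polynomial $X^{q_0+1}+uX^{q_0}+(u+1)X+1$ has no roots in $\mathbb{F}_q$. *)

(* Defs.v *)
From HB Require Import structures.
From mathcomp Require Import all_boot all_order all_algebra all_fingroup all_field.
Unset Printing Implicit Defensive.
Import GRing.Theory.
Local Open Scope ring_scope.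

Section Defs.
Variables (F : finFieldType) (q0 : nat).

Definition Phi (a c : F) : 'M[F]_3 :=
  \matrix_(i < 3, j < 3)
    if i == j then 1
    else if (i == 1 :> nat) && (j == 0 :> nat) then a
    else if (i == 2 :> nat) && (j == 0 :> nat) then c
    else if (i == 2 :> nat) && (j == 1 :> nat) then a ^+ q0
    else 0.

Definition Psi (l : F) : 'M[F]_3 :=
  \matrix_(i < 3, j < 3)
    if i == j then
      (if i == 0 :> nat then 1 else if i == 1 :> nat then l else l ^+ q0.+1)
    else 0.

Definition Kset : pred 'M[F]_3 := [pred x | [exists a : F, exists c : F, x == Phi a c]].

Definition Kt := {x : 'M[F]_3 | x \in Kset}.

Definition Omega (u : F) : pred 'M[F]_3 :=
  [pred x | [exists a : F, (a != 0) && (x == Phi a (u * a ^+ q0.+1))]].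

Definition adj (u : F) : rel Kt :=
  fun x y => let z := val x *m invmx (val y) in (z \in Omega u) || (z \in Omega (u + 1)).

Definition AutGamma (u : F) : {set {perm Kt}} :=
  [set s : {perm Kt} | [forall x, forall y, adj u (s x) (s y) == adj u x y]].

(* the permutation group on K induced by G = HK: Psi_l * k acts by
   x |-> (Psi_l^-1 x Psi_l) k  (conjugation by H, right multiplication by K) *)
Definition Gperm : {set {perm Kt}} :=
  [set s : {perm Kt} | [exists l : F, exists k : Kt, (l != 0) &&
     [forall x, val (s x) == invmx (Psi l) *m val x *m Psi l *m val k]]].

Definition Uset : pred F :=
  [pred u | [exists eta : F, (#|F|.-1).-primitive_root eta &&
               (u == (1 + eta ^+ q0) / (eta + eta ^+ q0))]
            && [forall x : F, x ^+ q0.+1 + u * x ^+ q0 + (u + 1) * x + 1 != 0]].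

End Defs.

(* Main.v *)
(* Write A_a = Phi_{a, u a^(q0+1)} and B_a = Phi_{a, (u+1) a^(q0+1)}.  Since
   B_a is the inverse of A_a, the edges of Gamma_u carry the orientation
   x -> A_a x.  By (U1) and (U2) the neighbourhood of 1 is a generalized Petersen
   graph: its outer rim A_x -> A_(eta x) is a single cycle, its inner rims are the
   cycles of multiplication by theta = eta / (1 + eta), and its spokes join A_x to
   B_(x / (1 + eta)).  A path made of a rim edge and a spoke lies on an 8-cycle,
   while two consecutive rim edges do not, because an 8-cycle through them would
   make eta or theta a root of a nonzero polynomial of degree at most 6 over F_2.  Hence an
   automorphism fixing 1 preserves the spokes, and so maps the out-neighbours of 1
   all to out-neighbours or all to in-neighbours; by connectedness it preserves or
   reverses the whole orientation.  If it preserves it, it acts on the rims as a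
   rotation, with the same multiplier at every vertex, and lies in H.  If it
   reverses it, it is given by a -> m a^k on first coordinates, where a -> a^k is
   additive and swaps eta and theta; the fixed field of this involution has index 2
   in F_q, which is impossible since q = 2^f with f odd. *)
Require Import Defs.
From HB Require Import structures.
From mathcomp Require Import all_boot all_order all_algebra all_fingroup all_field.
From mathcomp Require Import ring.
Import GRing.Theory.
Local Open Scope ring_scope.
Set Implicit Arguments.
Unset Strict Implicit.

(** * Fields of characteristic 2 *)

Section FiniteField.
Variable F : finFieldType.

(** By Bezout [a * m = 1 + b * #|F|.-1] for some [a] and [b], so raising to the power [a] undoes
    raising to the power [m]. *)
Lemma expf_coprime_inj m :
  (0 < m)%N -> coprime m #|F|.-1 -> injective (fun x : F => x ^+ m).
Proof.
move=> m0 /eqP cm x y /= exy.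
have [b _ /dvdnP[a]] := Bezoutl #|F|.-1 m0; rewrite cm => eab.
have q0 : (0 < #|F|)%N by apply/card_gt0P; exists 0.
have pow z : z ^+ (a * m) = z :> F.
  rewrite -eab; elim: b {eab} => [|b IHb]; first by rewrite expr1.
  rewrite mulSn addnCA exprD IHb -exprSr prednK //.
  exact: expf_card.
by rewrite -[x]pow -[y]pow mulnC !exprM exy.
Qed.

Lemma primitive_root_pow (n : nat) (z x : F) :
  n = #|F|.-1 -> n.-primitive_root z -> x != 0 -> exists i, x = z ^+ i.
Proof.
move=> en pz x0; have /(prim_rootP pz) [i ->] : x ^+ n = 1; last by exists i.
apply: (mulfI x0); rewrite -exprS en prednK ?mulr1 ?expf_card //.
by apply/card_gt0P; exists 0.
Qed.

End FiniteField.

Section Numerals2.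
Variable F : finFieldType.
Hypothesis char2 : 2%N \in [pchar F].

Lemma two0 : 2 = 0 :> F.
Proof. exact: pcharf0 char2. Qed.

Lemma natr_odd n : n%:R = (odd n)%:R :> F.
Proof.
by rewrite -{1}(odd_double_half n) natrD -muln2 natrM two0 mulr0 addr0.
Qed.

Lemma opprn_odd n : - n%:R = (odd n)%:R :> F.
Proof. by rewrite (oppr_pchar2 char2); apply: natr_odd. Qed.

End Numerals2.

(** [ring] over a field of characteristic 2: the numerals that occur as coefficients are supplied
    with their parities. *)
Ltac ring2 :=
  lazymatch goal with c : is_true (2%N \in [pchar _]) |- _ =>
    ring: (two0 c) (natr_odd c 3 : 3 = 1) (natr_odd c 4 : 4 = 0) (natr_odd c 5 : 5 = 1)
      (natr_odd c 6 : 6 = 0) (natr_odd c 7 : 7 = 1) (natr_odd c 8 : 8 = 0)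
      (natr_odd c 9 : 9 = 1) (natr_odd c 10 : 10 = 0) (natr_odd c 11 : 11 = 1)
      (natr_odd c 12 : 12 = 0) (opprn_odd c 1 : - 1 = 1) (opprn_odd c 2 : - 2 = 0)
      (opprn_odd c 3 : - 3 = 1) (opprn_odd c 4 : - 4 = 0) (opprn_odd c 5 : - 5 = 1)
      (opprn_odd c 6 : - 6 = 0)
  end.

Section Characteristic2.
Variable F : finFieldType.
Hypothesis char2 : 2%N \in [pchar F].

Lemma addr_eq0_char2 (x y : F) : (x + y == 0) = (x == y).
Proof. by rewrite addr_eq0 (oppr_pchar2 char2). Qed.

(** In characteristic 2 an equation is a vanishing sum, so deriving one equation from another
    amounts to giving a cofactor [k]; what remains is an identity for [ring2]. *)
Lemma eq_char2 (k a b c d : F) : a = b -> c + d = k * (a + b) -> c = d.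
Proof.
by move=> -> /eqP; rewrite (addrr_pchar2 char2) mulr0 addr_eq0_char2 => /eqP.
Qed.

Lemma expr2n_char2 k (x y : F) : (x + y) ^+ (2 ^ k) = x ^+ (2 ^ k) + y ^+ (2 ^ k).
Proof.
elim: k x y => [|k IHk] x y; first by rewrite !expr1.
by rewrite expnS !exprM -IHk; congr (_ ^+ _); ring2.
Qed.

(** The degree 5 is absent because [f = 5] must be allowed; accordingly, no irreducible quintic
    arises in the relations below. *)
Definition outside_small_subfields (x : F) :=
  forall d, d \in [:: 1; 2; 3; 4; 6]%N -> x ^+ (2 ^ d) != x.

Section SmallRelations.
(* The cofactor [k] in the next lemmas is the quotient of [x ^+ (2 ^ d) + x], or of
   [x ^+ 32 + x ^+ 3 + 1] in the last one, by the polynomial assumed to vanish at [x]. *)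
Variable x : F.
Hypothesis ox : outside_small_subfields x.

Lemma quadratic_neq : x ^+ 2 <> x + 1.
Proof.
move=> e; case/eqP: (ox (erefl : 2 \in [:: 1; 2; 3; 4; 6]%N)).
by apply: (eq_char2 (k := x ^+ 2 + x) e); ring2.
Qed.

Lemma cubic_neq1 : x ^+ 3 <> x + 1.
Proof.
move=> e; case/eqP: (ox (erefl : 3 \in [:: 1; 2; 3; 4; 6]%N)).
by apply: (eq_char2 (k := x ^+ 5 + x ^+ 3 + x ^+ 2 + x) e); ring2.
Qed.

Lemma cubic_neq2 : x ^+ 3 <> x ^+ 2 + 1.
Proof.
move=> e; case/eqP: (ox (erefl : 3 \in [:: 1; 2; 3; 4; 6]%N)).
by apply: (eq_char2 (k := x ^+ 5 + x ^+ 4 + x ^+ 3 + x) e); ring2.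
Qed.

Lemma quartic_neq1 : x ^+ 4 <> x + 1.
Proof.
move=> e; case/eqP: (ox (erefl : 4 \in [:: 1; 2; 3; 4; 6]%N)).
by apply: (eq_char2 (k := x ^+ 12 + x ^+ 9 + x ^+ 8 + x ^+ 6 + x ^+ 4 + x ^+ 3 +
  x ^+ 2 + x) e);
  ring2.
Qed.

Lemma quartic_neq2 : x ^+ 4 <> x ^+ 3 + x ^+ 2 + x + 1.
Proof.
move=> e; case/eqP: (ox (erefl : 4 \in [:: 1; 2; 3; 4; 6]%N)).
by apply: (eq_char2 (k := x ^+ 12 + x ^+ 11 + x ^+ 7 + x ^+ 6 + x ^+ 2 + x) e); ring2.
Qed.

Lemma quartic_neq3 : x ^+ 4 <> x ^+ 3 + 1.
Proof.
move=> e; case/eqP: (ox (erefl : 4 \in [:: 1; 2; 3; 4; 6]%N)).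
by apply: (eq_char2 (k := x ^+ 12 + x ^+ 11 + x ^+ 10 + x ^+ 9 + x ^+ 7 + x ^+ 5 +
  x ^+ 4 + x) e);
  ring2.
Qed.

Lemma sextic_neq : x ^+ 6 <> x + 1.
Proof.
move=> e; case/eqP: (ox (erefl : 6 \in [:: 1; 2; 3; 4; 6]%N)).
(* Squaring this gives [x ^+ 64 = x ^+ 6 + 1 = x]. *)
have e32 : x ^+ 32 = x ^+ 3 + 1.
  by apply: (eq_char2 (k := x ^+ 26 + x ^+ 21 + x ^+ 20 + x ^+ 16 + x ^+ 14 + x ^+ 11 +
    x ^+ 10 + x ^+ 9 + x ^+ 8 + x ^+ 6 + x ^+ 2 + x + 1) e);
    ring2.
change (x ^+ (32 * 2) = x); rewrite exprM e32.
by apply: (eq_char2 (k := 1) e); ring2.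
Qed.

Lemma outside_neq0 : x != 0.
Proof.
by apply/eqP=> x0; case/eqP: (ox (erefl : 1 \in [:: 1; 2; 3; 4; 6]%N));
  rewrite x0 expr0n.
Qed.

Lemma sqr_inj_char2 (a b : F) : a ^+ 2 = b ^+ 2 -> a = b.
Proof.
by move/eqP; rewrite eqf_sqr (oppr_pchar2 char2) orbb => /eqP.
Qed.

Variable y : F.
Hypothesis xy : y * (1 + x) = x.

(* Up to sign, the net numbers of steps made on the two rims by a reduced walk of
   length 8 which starts with two steps on a rim and ends on this rim. *)
Definition relations : seq (int * int) :=
  [:: (Posz 2, Posz 4); (Posz 3, Posz 3); (Posz 4, Posz 2); (Posz 5, Posz 1);
      (Posz 3, Posz 1); (Posz 1, Posz 1); (Negz 0, Posz 1); (Posz 2, Posz 2);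
      (Posz 0, Posz 2); (Posz 1, Posz 3); (Posz 8, Posz 0); (Posz 2, Negz 3);
      (Posz 3, Negz 2); (Posz 4, Negz 1); (Posz 5, Negz 0); (Posz 3, Negz 0);
      (Posz 1, Negz 0); (Negz 0, Negz 0); (Posz 2, Negz 1); (Posz 0, Negz 1);
      (Posz 1, Negz 2)].

(** Since [y = x / (1 + x)], multiplying by a power of [1 + x] clears the denominators; [relN] does
    the same for negative exponents. *)
Let relP (i : int) (n : nat) : x ^ i * y ^ n = 1 -> x ^ (i + n) = (1 + x) ^+ n.
Proof.
rewrite -exprnP => e.
rewrite expfzDr ?outside_neq0 // -[x ^ n]/(x ^+ n) -{2}xy exprMn mulrA.
by rewrite e mul1r.
Qed.

Let relN (i : int) (n : nat) :
  x ^ i * y ^ (Negz n) = 1 -> x ^ i * (1 + x) ^+ n.+1 = x ^+ n.+1.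
Proof.
have y0 : y != 0 by apply: contraNneq outside_neq0 => y0; rewrite -xy y0 mul0r.
rewrite -[y ^ _]/(y ^- n.+1) => e; have -> : x ^ i = y ^+ n.+1.
  by rewrite -[RHS]mul1r -e mulfVK ?expf_neq0.
by rewrite -exprMn xy.
Qed.

(** Without denominators each relation reads [1 = 0] or is a polynomial equation whose irreducible
    factors over the prime field are [x], [x + 1] and the polynomials excluded above. *)
Lemma no_relation p : p \in relations -> x ^ p.1 * y ^ p.2 <> 1.
Proof.
have x0 := outside_neq0.
rewrite /relations.
case/predU1P=> [->|] /=.
  move=> e; have {}e : x ^+ 6 = (1 + x) ^+ 4 := relP e.
  by apply: cubic_neq2; apply: sqr_inj_char2; apply: (eq_char2 (k := 1) e); ring2.
case/predU1P=> [->|] /=.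
  move=> e; have {}e : x ^+ 6 = (1 + x) ^+ 3 := relP e.
  have /eqP : (x ^+ 2 + x + 1) * (x ^+ 4 + x ^+ 3 + 1) = 0.
    by apply: (eq_char2 (k := 1) e); ring2.
  rewrite mulf_eq0 => /orP[] /eqP {}e.
    by apply: quadratic_neq; apply: (eq_char2 (k := 1) e); ring2.
  by apply: quartic_neq3; apply: (eq_char2 (k := 1) e); ring2.
case/predU1P=> [->|] /=.
  move=> e; have {}e : x ^+ 6 = (1 + x) ^+ 2 := relP e.
  by apply: cubic_neq1; apply: sqr_inj_char2; apply: (eq_char2 (k := 1) e); ring2.
case/predU1P=> [->|] /=.
  move=> e; have {}e : x ^+ 6 = (1 + x) := relP e.
  by apply: sextic_neq; apply: (eq_char2 (k := 1) e); ring2.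
case/predU1P=> [->|] /=.
  move=> e; have {}e : x ^+ 4 = (1 + x) := relP e.
  by apply: quartic_neq1; apply: (eq_char2 (k := 1) e); ring2.
case/predU1P=> [->|] /=.
  move=> e; have {}e : x ^+ 2 = (1 + x) := relP e.
  by apply: quadratic_neq; apply: (eq_char2 (k := 1) e); ring2.
case/predU1P=> [->|] /=.
  move=> e; have {}e : 1 = (1 + x) := relP e.
  by case/eqP: (x0); apply: (eq_char2 (k := 1) e); ring2.
case/predU1P=> [->|] /=.
  move=> e; have {}e : x ^+ 4 = (1 + x) ^+ 2 := relP e.
  by apply: quadratic_neq; apply: sqr_inj_char2; apply: (eq_char2 (k := 1) e); ring2.
case/predU1P=> [->|] /=.
  move=> e; have {}e : x ^+ 2 = (1 + x) ^+ 2 := relP e.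
  by case/eqP: (oner_neq0 F); apply: (eq_char2 (k := 1) e); ring2.
case/predU1P=> [->|] /=.
  move=> e; have {}e : x ^+ 4 = (1 + x) ^+ 3 := relP e.
  by apply: quartic_neq2; apply: (eq_char2 (k := 1) e); ring2.
case/predU1P=> [->|] /=.
  move=> e; have {}e : x ^+ 8 = 1 := etrans (esym (mulr1 _)) e.
  case/eqP: (ox (erefl : 3 \in [:: 1; 2; 3; 4; 6]%N)).
  rewrite e; symmetry; do 3!apply: sqr_inj_char2.
  by rewrite -!exprM !expr1n.
case/predU1P=> [->|] /=.
  move=> e; have {}e : x ^+ 2 * (1 + x) ^+ 4 = x ^+ 4 := relN e.
  by apply: quadratic_neq; apply: sqr_inj_char2; apply: (mulfI x0); apply: (mulfI x0);
    apply: (eq_char2 (k := 1) e); ring2.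
case/predU1P=> [->|] /=.
  move=> e; have {}e : x ^+ 3 * (1 + x) ^+ 3 = x ^+ 3 := relN e.
  by apply: quadratic_neq; do 4!apply: (mulfI x0); apply: (eq_char2 (k := 1) e); ring2.
case/predU1P=> [->|] /=.
  move=> e; have {}e : x ^+ 4 * (1 + x) ^+ 2 = x ^+ 2 := relN e.
  by apply: quadratic_neq; apply: (mulfI x0); apply: sqr_inj_char2;
    apply: (eq_char2 (k := 1) e); ring2.
case/predU1P=> [->|] /=.
  move=> e; have {}e : x ^+ 5 * (1 + x) = x := relN e.
  have /eqP : (x ^+ 2 + x + 1) * (x ^+ 3 + x + 1) = 0.
    by apply: (mulfI x0); apply: (eq_char2 (k := 1) e); ring2.
  rewrite mulf_eq0 => /orP[] /eqP {}e.
    by apply: quadratic_neq; apply: (eq_char2 (k := 1) e); ring2.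
  by apply: cubic_neq1; apply: (eq_char2 (k := 1) e); ring2.
case/predU1P=> [->|] /=.
  move=> e; have {}e : x ^+ 3 * (1 + x) = x := relN e.
  by apply: cubic_neq2; apply: (mulfI x0); apply: (eq_char2 (k := 1) e); ring2.
case/predU1P=> [->|] /=.
  move=> e; have {}e : x * (1 + x) = x := relN e.
  by case/eqP: (x0); apply: (mulfI x0); apply: (eq_char2 (k := 1) e); ring2.
case/predU1P=> [->|] /=.
  move=> e; have {}e := relN e; have {}e : 1 + x = x ^+ 2.
    by rewrite -[RHS](congr1 (fun z => x * z) e); apply/esym/(mulVKf x0).
  by apply: quadratic_neq; apply: (eq_char2 (k := 1) e); ring2.
case/predU1P=> [->|] /=.
  move=> e; have {}e : x ^+ 2 * (1 + x) ^+ 2 = x ^+ 2 := relN e.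
  by case/eqP: (x0); apply: sqr_inj_char2; do 2!apply: (mulfI x0);
    apply: (eq_char2 (k := 1) e); ring2.
case/predU1P=> [->|] /=.
  move=> e; have {}e : 1 * (1 + x) ^+ 2 = x ^+ 2 := relN e.
  by case/eqP: (oner_neq0 F); apply: (eq_char2 (k := 1) e); ring2.
case/predU1P=> [->|] /=.
  move=> e; have {}e : x * (1 + x) ^+ 3 = x ^+ 3 := relN e.
  by apply: cubic_neq1; apply: (mulfI x0); apply: (eq_char2 (k := 1) e); ring2.
by [].
Qed.

End SmallRelations.
End Characteristic2.

(** * The group K in coordinates *)

Section Model.
Variables (F : finFieldType) (q0 : nat).
Hypothesis char2 : 2%N \in [pchar F].
Hypothesis expD : forall x y : F, (x + y) ^+ q0 = x ^+ q0 + y ^+ q0.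

Definition kmul (x y : F * F) : F * F := (x.1 + y.1, x.2 + y.2 + x.1 ^+ q0 * y.1).
Definition kinv (x : F * F) : F * F := (x.1, x.2 + x.1 ^+ q0.+1).
Definition kone : F * F := (0, 0).

Let addrr (x : F) : x + x = 0 := addrr_pchar2 char2 x.

Let expr0q : (0 : F) ^+ q0 = 0.
Proof. by apply: (addrI (0 ^+ q0)); rewrite -expD !addr0. Qed.

Lemma kmulA x y z : kmul x (kmul y z) = kmul (kmul x y) z.
Proof. by congr (_, _) => /=; rewrite ?expD; ring. Qed.

Lemma kmul1 x : kmul kone x = x.
Proof.
case: x => a c; congr (_, _) => /=; rewrite add0r //.
by rewrite expr0q mul0r addr0.
Qed.

Lemma kmulV x : kmul (kinv x) x = kone.
Proof. by congr (_, _) => /=; rewrite ?exprSr; ring2. Qed.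

Lemma kmulVr x : kmul x (kinv x) = kone.
Proof. by congr (_, _) => /=; rewrite ?exprSr; ring2. Qed.

Lemma kmulr1 x : kmul x kone = x.
Proof. by case: x => a c; congr (_, _) => /=; rewrite ?mulr0 !addr0. Qed.

Lemma kmulK x y : kmul (kmul y x) (kinv x) = y.
Proof. by rewrite -kmulA kmulVr kmulr1. Qed.

Lemma kmulVK x y : kmul (kmul y (kinv x)) x = y.
Proof. by rewrite -kmulA kmulV kmulr1. Qed.

Variable u : F.

(* [gen true a] and [gen false a] run through Omega_u and Omega_(u+1) *)
Definition gen (b : bool) (a : F) : F * F :=
  (a, (if b then u else u + 1) * a ^+ q0.+1).

(** The equation is [x = kmul (gen true (x.1 + y.1)) y] solved for the second coordinates, so
    [arc y x] is an edge directed from [y] to [x]. *)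
Definition arc (y x : F * F) :=
  (x.1 != y.1) &&
  (x.2 + y.2 == (x.1 + y.1) ^+ q0 * (u * x.1 + (u + 1) * y.1)).

Definition kadj x y := arc x y || arc y x.

Lemma gen_inv b a : kmul (gen b a) (gen (~~ b) a) = kone.
Proof. by case: b; congr (_, _) => /=; rewrite ?exprSr; ring2. Qed.

Lemma gen_sq b a : kmul (gen b a) (gen b a) = (0, a ^+ q0.+1).
Proof. by case: b; congr (_, _) => /=; rewrite ?exprSr; ring2. Qed.

Lemma genK b a x : kmul (gen (~~ b) a) (kmul (gen b a) x) = x.
Proof. by rewrite kmulA -{2}(negbK b) gen_inv kmul1. Qed.

Lemma arc_gen y x : arc y x -> x = kmul (gen true (x.1 + y.1)) y.
Proof.
case/andP=> _ /eqP e; rewrite [LHS]surjective_pairing; congr (_, _) => /=.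
  by rewrite -addrA addrr addr0.
by apply: (eq_char2 char2 (k := 1) e); rewrite exprSr; ring2.
Qed.

Lemma arc_gen_rev y x : arc y x -> y = kmul (gen false (x.1 + y.1)) x.
Proof.
move=> a; rewrite [in RHS](arc_gen a) /= -[RHS]/(kmul (gen (~~ true) _) _).
by rewrite -[X in gen _ X]addrA addrr addr0 genK.
Qed.

Lemma gen_arc a x : a != 0 -> arc x (kmul (gen true a) x).
Proof.
move=> a0; apply/andP; split=> /=; first by rewrite -subr_eq0 addrK.
by have -> : a + x.1 + x.1 = a; [ring2 | apply/eqP; rewrite exprSr; ring2].
Qed.

Lemma gen_arc_rev a x : a != 0 -> arc (kmul (gen false a) x) x.
Proof. by move=> a0; rewrite -{2}(genK false a x); apply: gen_arc. Qed.

Lemma gen_arcb b a x : a != 0 ->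
  if b then arc x (kmul (gen b a) x) else arc (kmul (gen b a) x) x.
Proof. by case: b; [apply: gen_arc | apply: gen_arc_rev]. Qed.

Lemma arc_mulr z y x : arc (kmul y z) (kmul x z) = arc y x.
Proof.
rewrite /arc /= (inj_eq (addIr _)); congr andb.
have -> : x.1 + z.1 + (y.1 + z.1) = x.1 + y.1 by ring2.
apply/eqP/eqP => e; apply: (eq_char2 char2 (k := 1) e); rewrite expD; ring2.
Qed.

Lemma arc_neq y x : arc y x -> x != y.
Proof. by case/andP=> h _; apply: contraNneq h => ->. Qed.

Lemma arc_asym y x : arc y x -> ~~ arc x y.
Proof.
move=> /andP[h /eqP e]; apply/negP=> /andP[_ /eqP e'].
have h0 : x.1 + y.1 != 0 by rewrite (addr_eq0_char2 char2).
case/eqP: (h0); have /eqP: (x.1 + y.1) ^+ q0 * (x.1 + y.1) = 0.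
  by apply: (eq_char2 char2 (k := 1) (etrans (esym e) (etrans (addrC _ _) e')));
    rewrite [y.1 + _]addrC; ring2.
by rewrite mulf_eq0 expf_eq0 (negPf h0) andbF.
Qed.

Hypothesis expS_inj : injective (fun x : F => x ^+ q0.+1).

(** The [gen true a] generate K: their squares [(0, a ^+ q0.+1)] run through all [(0, c)] since the
    power map is bijective, and one more factor supplies the first coordinate. *)
Lemma gen_ind (P : F * F -> Prop) : P kone ->
  (forall a x, a != 0 -> P x -> P (kmul (gen true a) x)) -> forall x, P x.
Proof.
move=> P0 PS.
have {}PS a x : P x -> P (kmul (gen true a) x).
  have [->|] := eqVneq a 0; last exact: PS.
  by rewrite /gen expr0n mulr0 kmul1.
case=> a c; have [g _ gK] := injF_bij expS_inj.
pose b := g (c + u * a ^+ q0.+1).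
have <- : kmul (gen true b) (kmul (gen true b) (kmul (gen true a) kone)) = (a, c).
  rewrite kmulr1 kmulA gen_sq /kmul /= gK; congr (_, _); first by rewrite add0r.
  by rewrite expr0q; ring2.
by do 3!apply/PS.
Qed.
End Model.

(** * The neighbourhood of the identity *)

Section Local.
Variables (F : finFieldType) (q0 : nat).
Hypothesis char2 : 2%N \in [pchar F].
Hypothesis q0_gt0 : (0 < q0)%N.
Hypothesis expD : forall x y : F, (x + y) ^+ q0 = x ^+ q0 + y ^+ q0.
Hypothesis expP_inj : injective (fun x : F => x ^+ q0.-1).
Variables u eta : F.
Hypothesis eta0 : eta != 0.
Hypothesis eta1 : 1 + eta != 0.
Hypothesis uE : u * (eta + eta ^+ q0) = 1 + eta ^+ q0.
Hypothesis noroot : forall x : F, x ^+ q0.+1 + u * x ^+ q0 + (u + 1) * x + 1 != 0.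

Local Notation gen := (gen q0 u).
Local Notation arc := (arc q0 u).

(** Dividing by [x * y] leaves an equality of [q0.-1]-th powers. This is what turns the arc
    equations below into linear ones. *)
Lemma expq_proportional (x y : F) :
  x != 0 -> y != 0 -> y * x ^+ q0 = x * y ^+ q0 -> x = y.
Proof.
move=> x0 y0; rewrite -(prednK q0_gt0) !exprS mulrA [RHS]mulrA [y * x]mulrC.
by move/(mulfI (mulf_neq0 x0 y0)); apply: expP_inj.
Qed.

Let eta1q : (1 + eta) ^+ q0 = 1 + eta ^+ q0.
Proof. by rewrite expD expr1n. Qed.

Let u1E : (u + 1) * (eta + eta ^+ q0) = 1 + eta.
Proof. by apply: (eq_char2 char2 (k := 1) uE); ring2. Qed.


Let neqS (a b : F) : a != b -> a + b != 0.
Proof. by rewrite (addr_eq0_char2 char2). Qed.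

(** By (U1), multiplying the arc equation by [eta + eta ^+ q0] replaces [u] by [(1 + eta) ^+ q0] and
    [u + 1] by [1 + eta]; the result is an instance of [expq_proportional]. The next two lemmas go
    the same way. *)
Lemma arc_true_true a b : a != 0 -> b != 0 ->
  arc (gen true a) (gen true b) = (b == eta * a).
Proof.
move=> a0 b0; rewrite /arc /=; apply/andP/eqP => [[ab /eqP e]| -> ].
  have sE : (1 + eta) * a = a + b; last by apply: (eq_char2 char2 (k := 1) sE); ring2.
  apply: expq_proportional.
  - exact: mulf_neq0.
  - by apply: neqS; rewrite eq_sym.
  rewrite exprMn eta1q -uE -u1E expD.
  by apply: (eq_char2 char2 (k := eta + eta ^+ q0) e); rewrite expD !exprSr; ring2.
split.
  apply: contraNneq eta1 => /esym e.
  by rewrite (addr_eq0_char2 char2); apply/eqP/(mulIf a0); rewrite mul1r.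
apply/eqP; apply: (eq_char2 char2 (k := a ^+ q0 * a) uE).
by rewrite expD !exprSr exprMn; ring2.
Qed.

Lemma arc_false_false a b : a != 0 -> b != 0 ->
  arc (gen false a) (gen false b) = ((1 + eta) * a == eta * b).
Proof.
move=> a0 b0; rewrite /arc /=; apply/andP/eqP => [[ab /eqP e]| ab].
  have sE : b = (1 + eta) * (a + b); last by apply: (eq_char2 char2 (k := 1) sE); ring2.
  apply: expq_proportional => //.
  - by apply: mulf_neq0 => //; apply: neqS; rewrite eq_sym.
  rewrite exprMn eta1q -uE -u1E expD.
  by apply: (eq_char2 char2 (k := eta + eta ^+ q0) e); rewrite expD !exprSr; ring2.
have -> : b = (1 + eta) * (b / (1 + eta)) by rewrite mulrC mulfVK.
have -> : a = eta * (b / (1 + eta)) by rewrite mulrA -ab mulrC mulKf.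
have c0 : b / (1 + eta) != 0 by rewrite mulf_neq0 ?invr_eq0.
move: (b / _) c0 => c c0; split.
  apply/eqP=> /(mulIf c0) /eqP; rewrite -subr_eq0 addrK; exact/negP/oner_neq0.
apply/eqP; apply: (eq_char2 char2 (k := c ^+ q0 * c) uE).
by rewrite expD !exprSr !exprMn eta1q; ring2.
Qed.

Lemma arc_false_true a b : a != 0 -> b != 0 ->
  arc (gen false b) (gen true a) = (a == (1 + eta) * b).
Proof.
move=> a0 b0; rewrite /arc /=; apply/andP/eqP => [[ab /eqP e]| -> ].
  apply: expq_proportional; rewrite ?mulf_neq0 //.
  rewrite exprMn eta1q -uE -u1E.
  by apply: (eq_char2 char2 (k := eta + eta ^+ q0) e); rewrite expD !exprSr; ring2.
split.
  apply: contra_neq eta0 => e; apply: (mulIf b0); rewrite mul0r.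
  by apply: (eq_char2 char2 (k := 1) e); ring2.
apply/eqP; apply: (eq_char2 char2 (k := b ^+ q0 * b) uE).
by rewrite expD !exprSr !exprMn eta1q; ring2.
Qed.

(** This is where (U2) enters: such an arc would make [a / b] a root of the excluded polynomial. *)
Lemma arc_true_false a b : a != 0 -> b != 0 ->
  arc (gen true a) (gen false b) = false.
Proof.
move=> a0 b0; apply/negP=> /andP[_ /eqP /= e].
case/eqP: (noroot (a / b)); move: e; have -> : a = a / b * b by rewrite mulfVK.
rewrite mulfK //; move: (a / b) => c e.
apply: (mulIf (mulf_neq0 (expf_neq0 q0 b0) b0)).
by apply: (eq_char2 char2 (k := 1) e); rewrite expD !exprSr !exprMn; ring2.
Qed.

Let theta := eta / (1 + eta).

Hypothesis out_eta : outside_small_subfields eta.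

Let thetaE : theta * (1 + eta) = eta.
Proof. by rewrite mulfVK. Qed.

Let theta0 : theta != 0.
Proof. by rewrite mulf_neq0 ?invr_eq0. Qed.

Let etaE : eta * (1 + theta) = theta.
Proof. by apply: (mulIf eta1); apply: (eq_char2 char2 (k := 1 + eta) thetaE); ring2. Qed.

(** [eta] is a rational function of [theta], so a subfield containing [theta] contains [eta]. *)
Let out_theta : outside_small_subfields theta.
Proof.
move=> d dP; apply: contraNneq (out_eta dP) => e; apply/eqP.
have := congr1 (fun z => z ^+ (2 ^ d)) thetaE.
rewrite /= exprMn (expr2n_char2 char2) expr1n e => e'.
have {}e' := congr1 (fun z => z * (1 + eta)) e'.
apply: (eq_char2 char2 (k := 1) e').
have -> : theta * (1 + eta ^+ (2 ^ d)) * (1 + eta) =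
  theta * (1 + eta) * (1 + eta ^+ (2 ^ d)) by ring.
by rewrite thetaE; ring2.
Qed.

(* The neighbourhood of the identity is a generalized Petersen graph: [(true, x)]
   and [(false, x)] are its outer and inner vertices, the two rims are the orbits
   of multiplication by [eta] and [theta], and [(true, x)], [(false, x)] are
   joined by a spoke. *)
Definition rim (b : bool) := if b then eta else theta.

Definition loc (v : bool * F) :=
  if v.1 then gen true v.2 else gen false (v.2 / (1 + eta)).

Definition edge (v w : bool * F) :=
  if v.1 == w.1 then (w.2 == rim v.1 * v.2) || (v.2 == rim v.1 * w.2)
  else v.2 == w.2.

Let div1_neq0 (x : F) : x != 0 -> x / (1 + eta) != 0.
Proof. by move=> x0; rewrite mulf_neq0 ?invr_eq0. Qed.

Lemma rim_neq0 b : rim b != 0. Proof. by case: b. Qed.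

Lemma arc_loc b b' x y : x != 0 -> y != 0 ->
  arc (loc (b, x)) (loc (b', y)) =
  if b then b' && (y == eta * x)
  else if b' then y == x else x == theta * y.
Proof.
move=> x0 y0; case: b b' => [] [] /=.
- exact: arc_true_true.
- by apply: arc_true_false => //; apply: div1_neq0.
- by rewrite arc_false_true ?div1_neq0 // mulrC mulfVK.
- rewrite arc_false_false ?div1_neq0 // mulrC mulfVK //; congr (_ == _).
  by rewrite mulrA mulrAC.
Qed.

Lemma kadj_loc v w : v.2 != 0 -> w.2 != 0 -> kadj q0 u (loc v) (loc w) = edge v w.
Proof.
case: v w => [b x] [b' y] /= x0 y0; rewrite /kadj !arc_loc // /edge /=.
by case: b b' => [] [] //=; rewrite ?orbF // 1?orbC // eq_sym.
Qed.

Lemma loc_inj v w : loc v = loc w -> v.2 != 0 -> w.2 != 0 -> v = w.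
Proof.
case: v w => [b x] [b' y] /= e x0 y0.
have n01 a c : a != 0 -> gen true a <> gen false c.
  move=> a0 [<-] /(mulIf (expf_neq0 _ a0)) /eqP; apply/negP.
  by rewrite -{1}[u]addr0 (inj_eq (addrI u)) eq_sym oner_eq0.
case: b b' e => [] [] /= e.
- by case: e => ->.
- by case: (n01 _ _ x0 e).
- by case: (n01 _ _ y0 (esym e)).
by case: e => /(mulIf (_ : _ != 0)) -> //; rewrite invr_eq0.
Qed.

Lemma kadj_one_loc v : v.2 != 0 -> kadj q0 u (kone F) (loc v).
Proof.
case: v => b x /= x0; rewrite /kadj.
have [b' [y [y0 ->]]] : exists b' y, y != 0 /\ loc (b, x) = gen b' y.
  by case: (b); [exists true, x | exists false, (x / (1 + eta)); split=> //;
    apply: div1_neq0].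
have := gen_arcb char2 expD u b' (kone F) y0.
by rewrite kmulr1; case: b' => h; rewrite h ?orbT.
Qed.

Lemma kadj_oneP z : kadj q0 u (kone F) z -> exists2 v, v.2 != 0 & z = loc v.
Proof.
case/orP=> a.
  exists (true, z.1 + 0); first by rewrite addr0; case/andP: a.
  exact: etrans (arc_gen char2 a) (kmulr1 _ _).
exists (false, (0 + z.1) * (1 + eta)).
  by rewrite mulf_neq0 // add0r eq_sym; case/andP: a.
rewrite /loc /= mulfK //; exact: etrans (arc_gen_rev char2 expD a) (kmulr1 _ _).
Qed.

(** * Walks and octagons in the neighbourhood of the identity *)

Definition move := option bool.

(** [Some true] and [Some false] step forwards and backwards along a rim; [None] crosses a spoke. *)
Definition act (m : move) (v : bool * F) :=
  if m is Some d then (v.1, (if d then rim v.1 else (rim v.1)^-1) * v.2)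
  else (~~ v.1, v.2).

Lemma edge_act v w : edge v w -> exists m, w = act m v.
Proof.
case: v w => [b x] [b' y]; rewrite /edge /=; case: eqP => [<-|/eqP bb'].
  case/orP=> /eqP ->; [by exists (Some true) | exists (Some false)].
  by rewrite /= mulKf ?rim_neq0.
by move=> /eqP <-; exists None; case: b b' bb' => [] [].
Qed.

Lemma act_edge m v : edge v (act m v).
Proof.
case: v m => [b x] [[]|]; rewrite /edge /= ?eqxx //; last by case: b.
by rewrite mulVKf ?rim_neq0 // eqxx orbT.
Qed.

Lemma act_neq0 m v : v.2 != 0 -> (act m v).2 != 0.
Proof.
by case: v m => [b x] [[]|] //= x0; rewrite mulf_neq0 ?invr_eq0 ?rim_neq0.
Qed.

Definition reduced (m m' : move) :=
  match m, m' with
  | Some d, Some d' => d == d'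
  | None, None => false
  | _, _ => true
  end.

Lemma act_back m m' v : ~~ reduced m m' -> act m' (act m v) = v.
Proof.
case: v m m' => [b x] [d|] [d'|] //=; last by rewrite negbK.
by case: d d' => [] [] //= _; rewrite ?mulVKf ?mulKf ?rim_neq0.
Qed.

(* Walks are tracked by codes: whether the walk is on the rim it started from, and
   the net number of steps made along this rim and along the other one. *)
Definition code : Type := bool * int * int.

Definition code_act (m : move) (c : code) : code :=
  let: (t, i, j) := c in
  if m is Some d then
    let k := if d then 1 else -1 in if t then (t, i + k, j) else (t, i, j + k)
  else (~~ t, i, j).

Definition decode b x (c : code) : bool * F :=
  let: (t, i, j) := c in (t == b, rim b ^ i * rim (~~ b) ^ j * x).

Lemma act_decode m b x c : act m (decode b x c) = decode b x (code_act m c).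
Proof.
have rV b' (d : bool) :
    (if d then rim b' else (rim b')^-1) = rim b' ^ (if d then 1 else -1).
  by case: d.
case: c => [[t i] j]; case: m => [d|] /=; last by case: t b => [] [].
case: t; rewrite /= rV expfzDr ?rim_neq0 //; congr (_, _).
  by rewrite !mulrA [rim b ^ i * _]mulrC.
by rewrite !mulrA [_ * rim b ^ i]mulrC -!mulrA; congr (_ * _); rewrite mulrCA.
Qed.

(** A search through all reduced continuations by [n] moves. A walk ending on the other rim is
    certainly not closed; one ending on its own rim must have a listed relation, up to sign, as its
    exponents. *)
Fixpoint check n m (c : code) :=
  if n is n'.+1 then
    all (fun m' => reduced m m' ==> check n' m' (code_act m' c))
      [:: Some true; Some false; None]
  else
    let: (t, i, j) := c in
    t ==> ((i, j) \in relations) || ((- i, - j) \in relations).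

Fixpoint nonbacktracking (a b : F * F) (s : seq (F * F)) :=
  if s is c :: s' then [&& kadj q0 u b c, c != a & nonbacktracking b c s']
  else true.

Lemma no_relation_rim b i j :
  ((i, j) \in relations) || ((- i, - j) \in relations) ->
  rim b ^ i * rim (~~ b) ^ j != 1.
Proof.
have nr p : p \in relations -> rim b ^ p.1 * rim (~~ b) ^ p.2 != 1.
  by move=> pr; apply/eqP; case: b; apply: no_relation pr.
case/orP=> [/nr //|/nr /=]; apply: contra_neq => e.
by rewrite -!invr_expz -invfM e invr1.
Qed.

Lemma decode_neq0 b x c : x != 0 -> (decode b x c).2 != 0.
Proof.
by move=> x0; case: c => [[t i] j] /=; rewrite !mulf_neq0 ?expfz_neq0 ?rim_neq0.
Qed.

(** Inside the neighbourhood of 1, a non-backtracking walk is a reduced sequence of moves, so the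
    search covers it, and [no_relation_rim] keeps its end away from the start. *)
Lemma check_closed n m b x c s : x != 0 -> check n m (code_act m c) ->
  size s = n -> all (kadj q0 u (kone F)) s ->
  nonbacktracking (loc (decode b x c)) (loc (decode b x (code_act m c))) s ->
  last (loc (decode b x (code_act m c))) s <> loc (b, x).
Proof.
move=> x0; elim: s n m c => [|z s IHs] n m c /[swap] /= <- /= ck.
  move=> _ _ /loc_inj-/(_ (decode_neq0 _ _ x0) x0).
  move: ck => /=; case: (code_act m c) => [[t i] j] /= ck [tb e].
  case: t tb ck => /= [_ /(no_relation_rim b)/eqP|]; last by case: (b).
  by apply; apply: (mulIf x0); rewrite mul1r.
case/andP=> /kadj_oneP[w w0 ->{z}] sN /and3P[].
rewrite kadj_loc ?decode_neq0 // => /edge_act[m' ->{w w0}] nb.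
have {nb} red : reduced m m'.
  by apply: contraNT nb => /act_back; rewrite -act_decode => ->.
rewrite act_decode; apply: IHs sN => //.
move: ck => /= /and4P[/implyP c1 /implyP c2 /implyP c3 _].
by case: m' red => [[]|].
Qed.

(** For adjacent [a] and [b] this is a closed walk of length 8 through [a], [b], [c]. Repeated
    vertices are tolerated, and injective edge-preserving maps fixing 1 carry such walks along. *)
Definition on_octagon (a b c : F * F) := exists s, [/\ size s = 6, last c s = a,
  all (kadj q0 u (kone F)) s & nonbacktracking a b (c :: s)].

Lemma rim_not_on_octagon d v : v.2 != 0 ->
  ~ on_octagon (loc (act (Some (~~ d)) v)) (loc v) (loc (act (Some d) v)).
Proof.
move=> v0; set w := act (Some (~~ d)) v.
have w0 : w.2 != 0 by apply: act_neq0.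
have wd : act (Some d) w = v by apply: (@act_back (Some (~~ d)) (Some d)); case: (d).
pose c0 : code := (true, 0, 0); pose c1 := code_act (Some d) c0.
have wE : w = decode w.1 w.2 c0.
  by rewrite /= !expr0z !mul1r -[true == _]/(w.1) -surjective_pairing.
have vE : v = decode w.1 w.2 c1 by rewrite -act_decode -wE wd.
(* Two equal rim moves from [w] are already made, so six of the eight remain to be searched. *)
have ck : check 6 (Some d) (code_act (Some d) c1) by rewrite /c1; case: (d); vm_compute.
case=> s [sz ls sN nb]; have {nb} : nonbacktracking (loc v) (loc (act (Some d) v)) s.
  by move: nb; move: (act _ v) => z /and3P[].
rewrite vE act_decode in ls * => nb; case: (check_closed w0 ck sz sN nb).
by rewrite ls -surjective_pairing.
Qed.

Lemma rim_sqr_neq1 b : rim b ^+ 2 != 1.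
Proof.
have : outside_small_subfields (rim b) by case: b.
move/(_ 1%N erefl); rewrite expn1; apply: contraNneq => e.
by rewrite e; apply/eqP/esym/(sqr_inj_char2 char2); rewrite e expr1n.
Qed.

Lemma act_act_neq m m' v : v.2 != 0 -> reduced m m' -> act m' (act m v) != v.
Proof.
case: v => b x /= x0; case: m m' => [d|] [d'|] //=.
- move/eqP <-; rewrite xpair_eqE eqxx /= mulrA.
  case: d; rewrite -?invfM -expr2; apply: contraNneq (rim_sqr_neq1 b) => e.
    by apply/eqP/(mulIf x0); rewrite mul1r.
  by rewrite -invr_eq1; apply/eqP/(mulIf x0); rewrite mul1r.
- by rewrite xpair_eqE /=; case: (b).
- by rewrite xpair_eqE /=; case: (b).
Qed.

Fixpoint walk v (ms : seq move) :=
  if ms is m :: ms' then act m v :: walk (act m v) ms' else [::].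

Lemma walk_all v ms : v.2 != 0 -> all (kadj q0 u (kone F)) (map loc (walk v ms)).
Proof.
elim: ms v => //= m ms IHms v v0.
by rewrite kadj_one_loc ?act_neq0 //= IHms ?act_neq0.
Qed.

Lemma walk_nonbacktracking v m ms : v.2 != 0 -> path reduced m ms ->
  nonbacktracking (loc v) (loc (act m v)) (map loc (walk (act m v) ms)).
Proof.
elim: ms v m => //= m' ms IHms v m v0 /andP[r p].
rewrite kadj_loc ?act_neq0 // act_edge IHms ?act_neq0 // andbT /=.
apply: contraNneq (act_act_neq v0 r) => e; apply/eqP.
by apply: (loc_inj e); rewrite ?act_neq0.
Qed.

Lemma spoke_on_octagon d v : v.2 != 0 ->
  on_octagon (loc (act (Some d) v)) (loc v) (loc (act None v)).
Proof.
move=> v0; pose w := act (Some d) v.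
have w0 : w.2 != 0 by apply: act_neq0.
have vE : act (Some (~~ d)) w = v by apply: (@act_back (Some d) (Some (~~ d))); case: (d).
(* The octagon makes one step each way on each rim, with a spoke after every step; it closes because
   multiplications by [eta] and [theta] commute. *)
pose ms := [:: Some d; None; Some d; None; Some (~~ d); None].
exists (map loc (walk (act None v) ms)); split.
- by [].
- rewrite /=; congr loc; case: (v) => b x /=; rewrite !negbK; congr (_, _).
  by case: (d); rewrite /= mulrCA ?mulVKf ?mulKf ?rim_neq0.
- by apply: walk_all; apply: act_neq0.
rewrite -/w -vE -map_cons.
by apply: (@walk_nonbacktracking w (Some (~~ d)) (None :: ms)) => //=; case: (d).
Qed.

(** * Automorphisms *)

Hypothesis expS_inj : injective (fun x : F => x ^+ q0.+1).
Hypothesis eta_gen : forall x : F, x != 0 -> exists i, x = eta ^+ i.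

Local Notation kmul := (kmul q0).
Local Notation one := (kone F).
Local Notation kadj := (kadj q0 u).

Lemma kadj_mulr z x y : kadj (kmul x z) (kmul y z) = kadj x y.
Proof. by rewrite /kadj !(arc_mulr char2 expD). Qed.

Definition endo (g : F * F -> F * F) :=
  injective g /\ forall x y, kadj x y -> kadj (g x) (g y).

Section FixOne.
Variable g : F * F -> F * F.
Hypothesis endo_g : endo g.
Hypothesis g1 : g one = one.

Let g_inj : injective g := proj1 endo_g.
Let g_adj := proj2 endo_g.

Lemma on_octagon_map a b c : on_octagon a b c -> on_octagon (g a) (g b) (g c).
Proof.
case=> s [sz ls sN nb]; exists (map g s); split.
- by rewrite size_map.
- by rewrite last_map ls.
- rewrite all_map; apply: sub_all sN => z /g_adj; by rewrite g1.
rewrite -map_cons; elim: (c :: s) {ls} a b nb => //= z s' IHs a b /and3P[bz za nb].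
by rewrite g_adj // (inj_eq g_inj) za IHs.
Qed.

Lemma loc_map v : v.2 != 0 -> exists2 w, w.2 != 0 & g (loc v) = loc w.
Proof. by move=> /kadj_one_loc/g_adj; rewrite g1 => /kadj_oneP. Qed.

Lemma act_map v w m : v.2 != 0 -> w.2 != 0 -> g (loc v) = loc w ->
  exists m', g (loc (act m v)) = loc (act m' w).
Proof.
move=> v0 w0 e; have : kadj (loc v) (loc (act m v)).
  by rewrite kadj_loc ?act_neq0 // act_edge.
move/g_adj; rewrite e; have [w' w'0 ->] := loc_map (act_neq0 m v0).
by rewrite kadj_loc // => /edge_act[m' ->]; exists m'.
Qed.

Lemma act_inj m m' v : v.2 != 0 -> act m v = act m' v -> m = m'.
Proof.
move=> v0; have nz (d : bool) : Some d <> None -> act (Some d) v != act None v.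
  by rewrite xpair_eqE /=; case: (v.1).
have r1 : rim v.1 * v.2 != (rim v.1)^-1 * v.2.
  rewrite (inj_eq (mulIf v0)); apply: contraNneq (rim_sqr_neq1 v.1) => e.
  by rewrite expr2 {2}e mulfV ?rim_neq0.
case: m m' => [[]|] [[]|] //= [] //.
- by move/eqP; rewrite (negPf r1).
- by move/eqP; case: (v.1).
- by move/esym/eqP; rewrite (negPf r1).
- by move/eqP; case: (v.1).
- by move/eqP; case: (v.1).
- by move/eqP; case: (v.1).
Qed.

(** If the spoke went to the rim step [d], then, with only three edges at [w], some rim step at [v]
    would go to the opposite step. The octagon through that step and the spoke would contradict
    [rim_not_on_octagon]. *)
Lemma spoke_map v w : v.2 != 0 -> w.2 != 0 -> g (loc v) = loc w ->
  g (loc (act None v)) = loc (act None w).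
Proof.
move=> v0 w0 e; have [[d|] e0 //] := act_map None v0 w0 e.
have inj m m' m1 : g (loc (act m v)) = loc (act m1 w) ->
    g (loc (act m' v)) = loc (act m1 w) -> m = m'.
  move=> <- /g_inj/loc_inj em; apply/esym/(act_inj v0)/em; exact: act_neq0.
suff [e1 oct] : exists e1, g (loc (act (Some e1) v)) = loc (act (Some (~~ d)) w).
  case: (@rim_not_on_octagon d w w0).
  by rewrite -oct -e -e0; apply/on_octagon_map/spoke_on_octagon.
have [m1 e1] := act_map (Some true) v0 w0 e.
have [m2 e2] := act_map (Some false) v0 w0 e.
have [em|n1] := eqVneq m1 (Some (~~ d)); first by exists true; rewrite e1 em.
have [em|n2] := eqVneq m2 (Some (~~ d)); first by exists false; rewrite e2 em.
have n12 : m1 != m2 by apply: contra_eqN e1 => /eqP ->; apply/eqP=> /inj-/(_ _ e2).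
have n10 : m1 != Some d by apply: contra_eqN e1 => /eqP ->; apply/eqP=> /inj-/(_ _ e0).
have n20 : m2 != Some d by apply: contra_eqN e2 => /eqP ->; apply/eqP=> /inj-/(_ _ e0).
by move: n1 n2 n12 n10 n20; case: m1 {e1} m2 {e2} (d) => [[]|] [[]|] [].
Qed.

(** The outer rim is a single orbit of [eta]. Following it from 1, the image never changes rim,
    because the spokes already go to spokes. *)
Lemma side_map : exists b, forall x, x != 0 -> exists2 y, y != 0 &
  g (loc (true, x)) = loc (b, y) /\ g (loc (false, x)) = loc (~~ b, y).
Proof.
have [[b y] y0 e] : exists2 w, w.2 != 0 & g (loc (true, 1)) = loc w.
  by apply: loc_map; apply: oner_neq0.
exists b => x /eta_gen[i ->{x}].
have ei0 j : eta ^+ j != 0 by apply: expf_neq0.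
suff [z z0 ez] : exists2 z, z != 0 & g (loc (true, eta ^+ i)) = loc (b, z).
  by exists z => //; split=> //; exact: (@spoke_map (true, _) (b, z) (ei0 i) z0 ez).
elim: i => [|i [z z0 ez]]; first by exists y.
have [[d|] ed] :=
  act_map (Some true) (ei0 i : (true, eta ^+ i).2 != 0) (z0 : (b, z).2 != 0) ez.
  exists ((if d then rim b else (rim b)^-1) * z).
    exact: (@act_neq0 (Some d) (b, z)).
  by rewrite exprS -[RHS]/(loc (act (Some d) (b, z))) -ed.
have es := spoke_map (ei0 i : (true, eta ^+ i).2 != 0) (z0 : (b, z).2 != 0) ez.
have /loc_inj em := g_inj (etrans ed (esym es)).
suff : Some true = None by [].
by apply: (act_inj (ei0 i : (true, eta ^+ i).2 != 0)); apply: em; apply: act_neq0;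
  apply: ei0.
Qed.

End FixOne.

Lemma arc_one_loc v : v.2 != 0 -> arc one (loc v) = v.1 /\ arc (loc v) one = ~~ v.1.
Proof.
case: v => b x /= x0.
suff [y y0 ->] : exists2 y, y != 0 & loc (b, x) = gen b y.
  have := gen_arcb char2 expD u b one y0; rewrite kmulr1.
  case: b => h; have := arc_asym char2 h; rewrite h; by move/negPf->.
by case: (b); [exists x | exists (x / (1 + eta)); first exact: div1_neq0].
Qed.

Definition arc_or_rev (b : bool) (x y : F * F) := if b then arc x y else arc y x.

Lemma arc_from_one x : arc one x -> exists2 a, a != 0 & x = loc (true, a).
Proof.
move=> a; have /kadj_oneP[[b y] y0 e] : kadj one x by rewrite /kadj a.
exists y => //; move: a; rewrite e.
by have [-> _] := arc_one_loc y0; case: (b).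
Qed.

Lemma arc_to_one x : arc x one -> exists2 a, a != 0 & x = loc (false, a).
Proof.
move=> a; have /kadj_oneP[[b y] y0 e] : kadj one x by rewrite /kadj a orbT.
exists y => //; move: a; rewrite e.
by have [_ ->] := arc_one_loc y0; case: (b).
Qed.

Lemma endo_translate g x : endo g ->
  endo (fun y => kmul (g (kmul y x)) (kinv q0 (g x))).
Proof.
case=> g_inj g_adj; split=> [y z /(congr1 (kmul^~ (g x)))|y z yz].
  rewrite !(kmulVK char2 expD) => /g_inj /(congr1 (kmul^~ (kinv q0 x))).
  by rewrite !(kmulK char2 expD).
by rewrite kadj_mulr; apply: g_adj; rewrite kadj_mulr.
Qed.

Lemma translate_one g x : kmul (g (kmul one x)) (kinv q0 (g x)) = one.
Proof. by rewrite (kmul1 expD) (kmulVr q0 char2). Qed.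

(** After translation to 1, the out-neighbours are the outer vertices and the in-neighbours the
    inner ones, so [side_map] applies. *)
Lemma orientation_at g x : endo g -> exists b, forall y,
  (arc x y -> arc_or_rev b (g x) (g y)) /\ (arc y x -> arc_or_rev b (g y) (g x)).
Proof.
move=> eg; have [b bP] := side_map (endo_translate x eg) (translate_one g x).
exists b => y; rewrite -(kmulVK char2 expD x y); move: (kmul y _) => z.
have aE c d : arc c (kmul d (kinv q0 (g x))) = arc (kmul c (g x)) d.
  by rewrite -(arc_mulr char2 expD u (g x)) (kmulVK char2 expD).
have Ea c d : arc (kmul d (kinv q0 (g x))) c = arc d (kmul c (g x)).
  by rewrite -(arc_mulr char2 expD u (g x)) (kmulVK char2 expD).
have -> : arc x (kmul z x) = arc one z.
  by rewrite -[RHS](arc_mulr char2 expD u x) (kmul1 expD).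
have -> : arc (kmul z x) x = arc z one.
  by rewrite -[RHS](arc_mulr char2 expD u x) (kmul1 expD).
split.
  case/arc_from_one=> a /bP[c c0 [e _]] ->.
  have := arc_one_loc (c0 : (b, c).2 != 0); rewrite -e /arc_or_rev aE Ea (kmul1 expD).
  by case: (b) => [] [].
case/arc_to_one=> a /bP[c c0 [_ e]] ->.
have := arc_one_loc (c0 : (~~ b, c).2 != 0); rewrite -e /arc_or_rev aE Ea (kmul1 expD).
by case: (b) => [] [].
Qed.

(** The two ends of an arc see the same image arc, which has only one direction; connectedness
    spreads the common value of [b]. *)
Lemma orientation g : endo g ->
  exists b, forall x y, arc x y -> arc_or_rev b (g x) (g y).
Proof.
move=> eg; have [b b1] := orientation_at one eg.
exists b => x y xy; suff /(_ x y) [h _] : forall x y,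
  (arc x y -> arc_or_rev b (g x) (g y)) /\ (arc y x -> arc_or_rev b (g y) (g x)).
  exact: h.
apply: (gen_ind char2 expD expS_inj b1) => a {}x a0 xP {xy}y.
have xa := gen_arc q0 char2 u x a0.
have [b' b'P] := orientation_at (kmul (gen true a) x) eg.
suff -> : b = b' by [].
have := (xP (kmul (gen true a) x)).1 xa; have := (b'P x).2 xa.
by case: (b) (b') => [] [] //= h; rewrite (negPf (arc_asym char2 h)).
Qed.

(** * Multipliers of orientation-preserving and orientation-reversing maps *)

Section Multiplier.
Variable k : nat.
Hypothesis etak : eta ^+ k = theta.

Definition kpow (b : bool) (x : F) := if b then x else x ^+ k.

(** A step by [eta] on the outer rim goes to a step by [eta], or, if arcs are reversed, by
    [theta = eta ^+ k] on the inner rim. Hence [eta ^+ i] goes to [m * eta ^+ i] or to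
    [m * (eta ^+ i) ^+ k]. *)
Lemma multiplier_at_one g b : endo g -> g one = one ->
    (forall x y, arc x y -> arc_or_rev b (g x) (g y)) ->
  (b = false -> theta ^+ k = eta) /\
  exists2 m, m != 0 & forall c x, x != 0 ->
    g (gen c x) = gen (c == b) (m * kpow b x).
Proof.
move=> eg g1 bP; have [b' b'P] := side_map eg g1.
have bb' : b' = b.
  have [y y0 [e _]] := b'P 1 (oner_neq0 F).
  have := arc_one_loc (y0 : (b', y).2 != 0).
  have := bP one (loc (true, 1)); rewrite g1 e.
  have [-> _] := arc_one_loc (oner_neq0 F : (true, 1).2 != 0).
  by move/(_ isT); rewrite /arc_or_rev; case: b {bP} => -> [/=]; case: (b').
subst b'; have [m m0 [m1 _]] := b'P 1 (oner_neq0 F).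
have kpow0 x : x != 0 -> kpow b x != 0.
  by rewrite /kpow; case: (b) => // x0; apply: expf_neq0.
have gT x : x != 0 -> g (loc (true, x)) = loc (b, m * kpow b x).
  case/eta_gen=> i ->; elim: i => [|i IHi].
    by rewrite m1 /kpow; case: (b); rewrite ?expr1n mulr1.
  have [|y y0 [e _]] := b'P (eta ^+ i.+1); first exact: expf_neq0.
  have := bP (loc (true, eta ^+ i)) (loc (true, eta ^+ i.+1)).
  rewrite arc_loc ?expf_neq0 //= exprS eqxx => /(_ isT).
  rewrite -exprS e IHi /arc_or_rev !arc_loc ?mulf_neq0 ?kpow0 ?expf_neq0 //.
  rewrite /kpow; case: (b) => /= /eqP ->.
    by rewrite mulrCA -exprS.
  by congr (loc (_, _)); rewrite exprS exprMn etak mulrCA.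
have gF x : x != 0 -> g (loc (false, x)) = loc (~~ b, m * kpow b x).
  move=> x0; have [y y0 [e ->]] := b'P x x0.
  move: e; rewrite gT // => /loc_inj; rewrite mulf_neq0 ?kpow0 //.
  by move=> /(_ isT y0) [->].
have tk : b = false -> theta ^+ k = eta.
  move=> b0; have := bP (loc (false, theta)) (loc (false, 1)).
  rewrite arc_loc ?oner_neq0 //= mulr1 eqxx => /(_ isT).
  rewrite !gF ?oner_neq0 // /arc_or_rev b0 arc_loc ?mulf_neq0 ?expf_neq0 ?oner_neq0 //.
  by rewrite /= expr1n mulr1 mulrC => /eqP/(mulIf m0).
split=> //; case: b {b'P} kpow0 bP m1 gT gF tk => kpow0 bP m1 gT gF tk.
  exists m => // -[] x x0; first exact: gT.
  have := gF (x * (1 + eta)); rewrite mulf_neq0 // => /(_ isT).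
  by rewrite /loc /= mulrA !mulfK.
exists (m / (1 + eta)); first by rewrite mulf_neq0 ?invr_eq0.
(* The [k]-th power exchanges [eta] and [theta], hence inverts their quotient [1 + eta]. *)
have e1k : (1 + eta) ^+ k = (1 + eta)^-1.
  apply: (mulfI eta0); rewrite -{1}(tk erefl) -exprMn thetaE.
  exact: etak.
case=> x x0; first by rewrite -[LHS]/(g (loc (true, x))) gT //= /loc /= mulrAC.
have := gF (x * (1 + eta)); rewrite mulf_neq0 // => /(_ isT).
by rewrite /loc /= mulfK // => ->; rewrite exprMn e1k mulrA mulrAC.
Qed.

Lemma multiplier_at g b x : endo g ->
    (forall x y, arc x y -> arc_or_rev b (g x) (g y)) ->
  (b = false -> theta ^+ k = eta) /\
  exists2 m, m != 0 & forall c a, a != 0 ->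
    g (kmul (gen c a) x) = kmul (gen (c == b) (m * kpow b a)) (g x).
Proof.
move=> eg bP.
have [|tk [m m0 mP]] := @multiplier_at_one _ b (endo_translate x eg) (translate_one g x).
  move=> y z yz; rewrite /arc_or_rev !(arc_mulr char2 expD).
  by apply: bP; rewrite (arc_mulr char2 expD).
split=> //; exists m => // c a a0.
by rewrite -mP // (kmulVK char2 expD).
Qed.

Lemma kpow_neq0 b x : x != 0 -> kpow b x != 0.
Proof. by rewrite /kpow; case: b => // x0; apply: expf_neq0. Qed.

(** The multipliers at [x] and at [kmul (gen true a) x] agree, since [gen false a] leads back to
    [x]: compare first coordinates. *)
Lemma multiplier g b : endo g ->
    (forall x y, arc x y -> arc_or_rev b (g x) (g y)) ->
  (b = false -> theta ^+ k = eta) /\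
  exists2 m, m != 0 & forall x c a, a != 0 ->
    g (kmul (gen c a) x) = kmul (gen (c == b) (m * kpow b a)) (g x).
Proof.
move=> eg bP; have [tk [m m0 mP]] := multiplier_at one eg bP.
split=> //; exists m => //; apply: (gen_ind char2 expD expS_inj mP) => a x a0 xP.
have [_ [m' m'0 m'P]] := multiplier_at (kmul (gen true a) x) eg bP.
suff <- : m' = m by exact: m'P.
have := m'P false a a0; rewrite (genK char2 expD u true) xP //.
move/(congr1 (fun z : F * F => z.1)) => /= e.
apply: (mulIf (kpow_neq0 b a0)).
by apply: (eq_char2 char2 (k := 1) e); ring2.
Qed.

(** Since the squares of generators fill all [(0, c)], the first coordinate of [g x] depends on
    [x.1] only, as [m * x.1 ^+ k] plus a constant. Prefixing a generator then yields additivity. *)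
Lemma reversing_additive g : endo g ->
    (forall x y, arc x y -> arc_or_rev false (g x) (g y)) ->
  theta ^+ k = eta /\ forall x y : F, (x + y) ^+ k = x ^+ k + y ^+ k.
Proof.
move=> eg bP; have [/(_ erefl) tk [m m0 mP]] := multiplier eg bP.
split=> //; have k0 : (0 < k)%N.
  rewrite lt0n; apply: contraNneq (rim_sqr_neq1 true) => k0.
  by rewrite /rim -tk k0 expr0 expr1n.
have g1 a x : (g (kmul (gen true a) x)).1 = m * a ^+ k + (g x).1.
  have [->|a0] := eqVneq a 0; last by rewrite mP.
  have -> : gen true 0 = one by rewrite -[gen _ _]/(0, _) expr0n mulr0.
  by rewrite (kmul1 expD) expr0n -[k == _]negbK -lt0n k0 mulr0 add0r.
have gZ c x : (g (kmul (0, c) x)).1 = (g x).1.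
  have [h _ hK] := injF_bij expS_inj.
  rewrite -[c]hK -(gen_sq q0 char2 u true) -(kmulA expD) !g1.
  by rewrite addrA (addrr_pchar2 char2) add0r.
have gE x : (g x).1 = m * x.1 ^+ k + (g one).1.
  have {1}-> : x = kmul (gen true x.1) (kmul (0, x.2 + u * x.1 ^+ q0.+1) one).
    by rewrite kmulr1 [LHS]surjective_pairing; congr (_, _) => /=; ring2.
  by rewrite g1 gZ.
move=> x y; have := g1 x (y, 0); rewrite (gE (y, 0)) gE /= => e.
by apply: (mulfI m0); apply: (eq_char2 char2 (k := 1) e); ring2.
Qed.

End Multiplier.

Lemma theta_pow : exists k, eta ^+ k = theta.
Proof. by have [k ->] := eta_gen theta0; exists k. Qed.

(* The power map fixes a subfield [E] and moves [v = eta^-1] to [v + 1], so that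
   [1, v] is a basis of [F] over [E]. *)
Lemma additive_swap_card k : eta ^+ k = theta -> theta ^+ k = eta ->
  (forall x y : F, (x + y) ^+ k = x ^+ k + y ^+ k) -> exists n, #|F| = (n ^ 2)%N.
Proof.
move=> etak thetak powD; have pow0 : (0 : F) ^+ k = 0.
  by apply: (addrI (0 ^+ k)); rewrite -powD !addr0.
have powK (x : F) : (x ^+ k) ^+ k = x.
  have [->|/eta_gen[i ->]] := eqVneq x 0; first by rewrite !pow0.
  by rewrite -!exprM mulnC !exprM etak thetak.
pose v := eta^-1; have vk : v ^+ k = v + 1.
  by rewrite exprVn etak invf_div mulrDl mul1r divff.
pose E := [set x : F | x ^+ k == x].
(* For [x = b + a * v] with [a] and [b] in [E], [h x] is the coordinate pair [(a, b)], as
   [x ^+ k = x + a]. *)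
pose h (x : F) := (x + x ^+ k, x + (x + x ^+ k) * v).
have h_inj : injective h by move=> x y [-> /addIr].
exists #|E|; rewrite -cardsT -(card_imset _ h_inj) expnS expn1 -cardsX.
congr #|pred_of_set _|; apply/setP=> -[a b]; rewrite !inE /=.
apply/imsetP/andP=> [[x _ [-> ->]]|[/eqP ea /eqP eb]].
  rewrite !powD exprMn !powD powK vk; split; apply/eqP; ring2.
exists (b + a * v); rewrite ?inE // /h powD exprMn vk ea eb.
by congr (_, _); ring2.
Qed.

Variable f : nat.
Hypothesis cardF : #|F| = (2 ^ f)%N.
Hypothesis odd_f : odd f.

Lemma card_not_square n : #|F| <> (n ^ 2)%N.
Proof.
rewrite cardF => /(congr1 (logn 2)); rewrite pfactorK // lognX => e.
by move: odd_f; rewrite e oddM.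
Qed.

(** Reversal would make [#|F|] a square, against [f] odd. Otherwise induction along generators
    works, since the dilation by [m] is multiplicative on K and sends [gen true a] to
    [gen true (m * a)]. *)
Lemma endo_form g : endo g -> exists2 m, m != 0 &
  forall x, g x = kmul (m * x.1, m ^+ q0.+1 * x.2) (g one).
Proof.
move=> eg; have [k etak] := theta_pow; have [[] bP] := orientation eg; last first.
  have [thetak powD] := reversing_additive etak eg bP.
  by have [n /card_not_square] := additive_swap_card etak thetak powD.
have [_ [m m0 mP]] := multiplier etak eg bP; exists m => //.
apply: (gen_ind char2 expD expS_inj (u := u)) => [|a x a0 xP].
  by rewrite /= !mulr0 (kmul1 expD).
rewrite mP // xP (kmulA expD); congr (kmul _ _).
congr (_, _) => /=; first by rewrite mulrDr.
by rewrite !exprMn !exprS; ring.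
Qed.

End Local.

(** * Transfer to matrices *)

Section Transfer.
Variables (F : finFieldType) (q0 : nat).
Hypothesis char2 : 2%N \in [pchar F].
Hypothesis expD : forall x y : F, (x + y) ^+ q0 = x ^+ q0 + y ^+ q0.

Local Notation kmul := (kmul q0).
Local Notation kinv := (kinv q0).
Local Notation one := (kone F).

Definition kmx (p : F * F) : 'M[F]_3 := Phi F q0 p.1 p.2.

Let i0 : 'I_3 := inord 0.
Let i1 : 'I_3 := inord 1.
Let i2 : 'I_3 := inord 2.

Lemma kmx_inj : injective kmx.
Proof.
move=> [a c] [b d] e.
have := congr1 (fun M : 'M_3 => M i1 i0) e; have := congr1 (fun M : 'M_3 => M i2 i0) e.
by rewrite !mxE -!val_eqE /= !inordK //= => -> ->.
Qed.

Let expr0q : (0 : F) ^+ q0 = 0.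
Proof. by apply: (addrI (0 ^+ q0)); rewrite -expD !addr0. Qed.

Lemma kmxM x y : kmx (kmul x y) = kmx x *m kmx y.
Proof.
apply/matrixP=> i j; rewrite !mxE !big_ord_recl big_ord0 !mxE.
case: i => [[|[|[|//]]] ?]; case: j => [[|[|[|//]]] ?] //=; rewrite ?expD; ring.
Qed.

Lemma kmx1 : kmx one = 1%:M.
Proof.
apply/matrixP=> i j; rewrite !mxE expr0q.
by case: i => [[|[|[|//]]] ?]; case: j => [[|[|[|//]]] ?].
Qed.

Lemma kmxV x : kmx (kinv x) = invmx (kmx x).
Proof.
have e : kmx (kinv x) *m kmx x = 1%:M by rewrite -kmxM (kmulV q0 char2) kmx1.
have [_ ux] := mulmx1_unit e.
by rewrite -[LHS]mulmx1 -(mulmxV ux) mulmxA e mul1mx.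
Qed.

Lemma PsiV l : l != 0 -> invmx (Psi F q0 l) = Psi F q0 l^-1.
Proof.
move=> l0; have e : Psi F q0 l^-1 *m Psi F q0 l = 1%:M.
  apply/matrixP=> i j; rewrite !mxE !big_ord_recl big_ord0 !mxE.
  case: i => [[|[|[|//]]] ?]; case: j => [[|[|[|//]]] ?] //=;
    rewrite ?(mul0r, mulr0, addr0, add0r, mulr1) //; first by rewrite mulVf.
  by rewrite exprVn mulVf // expf_neq0.
have [_ ux] := mulmx1_unit e.
by rewrite -[LHS]mul1mx -e mulmxK.
Qed.

Lemma kmxJ l x : l != 0 ->
  invmx (Psi F q0 l) *m kmx x *m Psi F q0 l = kmx (l^-1 * x.1, l^-1 ^+ q0.+1 * x.2).
Proof.
move=> l0; rewrite PsiV //; apply/matrixP=> i j; rewrite !mxE !big_ord_recl big_ord0.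
rewrite !mxE !big_ord_recl !big_ord0 !mxE.
case: i => [[|[|[|//]]] ?]; case: j => [[|[|[|//]]] ?] //=;
  rewrite ?(mul0r, mulr0, addr0, add0r, mulr1, mul1r, mulVf) //.
  by rewrite exprMn exprSr mulrAC mulfVK // mulrC.
by rewrite -exprMn mulVf // expr1n.
Qed.

Lemma kmx_mem p : kmx p \in Kset F q0.
Proof. by apply/existsP; exists p.1; apply/existsP; exists p.2. Qed.

Definition to_Kt p : Kt F q0 := exist _ (kmx p) (kmx_mem p).
Definition of_Kt (x : Kt F q0) : F * F := (val x i1 i0, val x i2 i0).

Lemma to_KtK : cancel to_Kt of_Kt.
Proof. by case=> a c; rewrite /of_Kt /= !mxE -!val_eqE /= !inordK. Qed.

Lemma of_KtK : cancel of_Kt to_Kt.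
Proof.
case=> x xK; have [a /existsP[c /eqP e]] := existsP xK.
have xE : exist _ x xK = to_Kt (a, c) by apply: val_inj.
by rewrite xE to_KtK.
Qed.

Variable u : F.

Lemma adj_to_Kt x y : adj F q0 u (to_Kt x) (to_Kt y) = kadj q0 u x y.
Proof.
rewrite /adj /= -kmxV -kmxM /kadj orbC.
set z := kmul x (kinv y); have -> : x = kmul z y by rewrite (kmulVK char2 expD).
have -> : arc q0 u (kmul z y) y = arc q0 u z one.
  by rewrite -[RHS](arc_mulr char2 expD u y) (kmul1 expD).
have -> : arc q0 u y (kmul z y) = arc q0 u one z.
  by rewrite -[RHS](arc_mulr char2 expD u y) (kmul1 expD).
congr (_ || _); apply/existsP/idP.
- case=> a /andP[a0 /eqP]; rewrite -[Phi _ _ _ _]/(kmx (gen q0 u false a)) => /kmx_inj ->.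
  by have := gen_arc_rev char2 expD u one a0; rewrite kmulr1.
- move=> az; exists z.1; have [+ _] := andP az; rewrite eq_sym => -> /=.
  have := arc_gen_rev char2 expD az; rewrite kmulr1 => zE.
  by rewrite {1}zE; apply/eqP; congr Phi; rewrite /= add0r.
- case=> a /andP[a0 /eqP]; rewrite -[Phi _ _ _ _]/(kmx (gen q0 u true a)) => /kmx_inj ->.
  by have := gen_arc q0 char2 u one a0; rewrite kmulr1.
move=> az; exists z.1; have [+ _] := andP az; move=> -> /=.
have := arc_gen char2 az; rewrite kmulr1 => zE.
by rewrite {1}zE; apply/eqP; congr Phi; rewrite /= addr0.
Qed.

Lemma arc_dilate m x y : m != 0 ->
  arc q0 u (m * x.1, m ^+ q0.+1 * x.2) (m * y.1, m ^+ q0.+1 * y.2) = arc q0 u x y.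
Proof.
move=> m0; rewrite /arc /= (inj_eq (mulfI m0)) -!mulrDr exprMn; congr (_ && _).
have -> : m ^+ q0 * (y.1 + x.1) ^+ q0 * (u * (m * y.1) + (u + 1) * (m * x.1)) =
  m ^+ q0.+1 * ((y.1 + x.1) ^+ q0 * (u * y.1 + (u + 1) * x.1)) by rewrite exprS; ring.
by rewrite (inj_eq (mulfI (expf_neq0 _ m0))).
Qed.

End Transfer.

(** * From the numerical hypotheses to the theorem *)

Lemma dvdn_pred_pow2 f d : (0 < d < f)%N -> ~~ ((2 ^ f).-1 %| (2 ^ d).-1)%N.
Proof.
case/andP=> d0 df; apply/negP=> /dvdn_leq.
have d1 : (1 < 2 ^ d)%N by rewrite (ltn_exp2l 0).
rewrite -subn1 subn_gt0 d1 => /(_ isT); rewrite subn1 leqNgt.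
have : (2 ^ d < 2 ^ f)%N by rewrite ltn_exp2l.
by case: (2 ^ d)%N d1 => // k; case: (2 ^ f)%N => //= l _; rewrite ltnS => ->.
Qed.

Theorem theorem3p1 (F : finFieldType) (f e : nat)
  (hF : #|F| = (2 ^ f)%N) (hf : (4 <= f)%N)
  (hq0 : (2 ^ e < 2 ^ f)%N)
  (hgcd : gcdn (2 ^ f).-1 ((2 ^ e) ^ 2).-1 = 1%N) :
  (forall u : F,
     symmetric (adj F (2 ^ e) u) /\ irreflexive (adj F (2 ^ e) u) /\
     (forall x y : Kt F (2 ^ e), connect (adj F (2 ^ e) u) x y))
  /\
  (forall u : F, u \in Uset F (2 ^ e) -> AutGamma F (2 ^ e) u = Gperm F (2 ^ e)).
Proof.
have char2 : 2%N \in [pchar F] by apply: (card_finPcharP hF).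
set q0 := (2 ^ e)%N.
have expD (x y : F) : (x + y) ^+ q0 = x ^+ q0 + y ^+ q0 by apply: expr2n_char2.
have n1 : (2 ^ f).-1 != 1%N.
  have : (2 ^ 4 <= 2 ^ f)%N by rewrite leq_exp2l.
  by case: (2 ^ f)%N => [|[|[|]]].
have e0 : (0 < e)%N.
  by rewrite lt0n; apply: contra_eqN hgcd => /eqP ->; rewrite gcdn0.
have q0_gt1 : (1 < q0)%N by rewrite (ltn_exp2l 0).
have q0_gt0 := ltnW q0_gt1.
have predE : ((q0 ^ 2).-1 = q0.-1 * q0.+1)%N.
  by rewrite -subn1 -[in LHS](exp1n 2) subn_sqr addn1 subn1.
have co m : (m %| (q0 ^ 2).-1 -> coprime m #|F|.-1)%N.
  move=> dm; rewrite hF; apply: coprime_dvdl dm _.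
  by rewrite coprime_sym /coprime hgcd.
have expP_inj : injective (fun x : F => x ^+ q0.-1).
  apply: expf_coprime_inj; first by rewrite -subn1 subn_gt0.
  by apply: co; rewrite predE dvdn_mulr.
have expS_inj : injective (fun x : F => x ^+ q0.+1).
  by apply: expf_coprime_inj => //; apply: co; rewrite predE dvdn_mull.
(* For even [f], 3 would divide both [2 ^ f - 1] and [q0 ^ 2 - 1]. *)
have odd_f : odd f.
  apply: contra_eqT hgcd => /negPf fE.
  have three k : (3 %| (4 ^ k).-1)%N by apply: (dvdn_pred_predX 4).
  have d3 : (3 %| gcdn (2 ^ f).-1 (q0 ^ 2).-1)%N.
    rewrite dvdn_gcd -expnM mulnC expnM three andbT.
    by rewrite -(odd_double_half f) fE add0n -mul2n expnM.
  by apply: contraTneq d3 => ->.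
have f5 : (4 < f)%N by rewrite ltn_neqAle hf andbT; apply: contraTneq odd_f => <-.
pose K := @to_Kt F q0; pose K' := @of_Kt F q0.
have KK : cancel K K' := @to_KtK F q0.
have KK' : cancel K' K := @of_KtK F q0.
have adjE u x y : adj F q0 u x y = kadj q0 u (K' x) (K' y).
  by rewrite -(adj_to_Kt char2 expD) -/K !KK'.
have sym u : symmetric (adj F q0 u) by move=> x y; rewrite !adjE /kadj orbC.
split=> u.
  split=> //; split=> [x|x y].
    by rewrite adjE /kadj orbb; apply/negbTE/negP=> /arc_neq/eqP.
  have c1 z : connect (adj F q0 u) (K z) (K (kone F)).
    move: z; apply: (gen_ind char2 expD expS_inj (u := u)) => // a z a0.
    by apply: connect_trans; apply: connect1;
      rewrite adjE !KK /kadj (gen_arc q0 char2) ?orbT.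
  rewrite -[x]KK' -[y]KK'; apply: connect_trans (c1 _) _.
  by rewrite (sym_connect_sym (sym u)).
case/andP=> /existsP[eta /andP[eta_prim /eqP uE]] /forallP noroot.
rewrite hF in eta_prim.
have n0 : (0 < (2 ^ f).-1)%N by apply: prim_order_gt0 eta_prim.
have eta0 : eta != 0.
  apply/eqP=> eta_eq0; move: (prim_expr_order eta_prim); rewrite eta_eq0 expr0n.
  by rewrite eqn0Ngt n0 => /esym/eqP; rewrite oner_eq0.
have eta_fix d : eta ^+ (2 ^ d) = eta -> ((2 ^ f).-1 %| (2 ^ d).-1)%N.
  move=> h; rewrite (prim_order_dvd eta_prim); apply/eqP/(mulfI eta0).
  by rewrite -exprS prednK ?expn_gt0 // mulr1.
have etaq : eta + eta ^+ q0 != 0.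
  rewrite (addr_eq0_char2 char2) eq_sym; apply/eqP=> /eta_fix; apply/negP.
  by apply: dvdn_pred_pow2; rewrite e0 -(ltn_exp2l _ _ (isT : 1 < 2)%N).
have eta1 : 1 + eta != 0.
  rewrite (addr_eq0_char2 char2); apply/eqP=> h.
  have := prim_order_dvd eta_prim 1; rewrite -h expr1n eqxx dvdn1.
  by rewrite (negPf n1).
have out_eta : outside_small_subfields eta.
  move=> d dP; apply/eqP=> /eta_fix; apply/negP.
  have [df|] := ltnP d f; first by apply: dvdn_pred_pow2; rewrite df andbT; case: d dP {df}.
  (* As [f] is odd and at least 5, [f <= d] leaves only [d = 6] and [f = 5], where 31 does not
     divide 63. *)
  move=> fd; have d6 : d = 6.
    move: fd; apply: contraTeq; rewrite -ltnNge => d6; apply: leq_trans f5.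
    by move: dP d6; rewrite !inE; do 4?[case/predU1P=> [->//|]]; move=> /eqP ->.
  have f6 : f != 6 by apply: contraTneq odd_f => ->.
  rewrite d6 in fd; have -> : f = 5.
    by apply/eqP; rewrite eqn_leq f5 andbT -ltnS ltn_neqAle f6.
  by rewrite d6.
have {}uE : u * (eta + eta ^+ q0) = 1 + eta ^+ q0 by rewrite uE mulfVK.
have eta_gen (x : F) : x != 0 -> exists i, x = eta ^+ i.
  by apply: primitive_root_pow eta_prim; rewrite hF.
have form := endo_form char2 q0_gt0 expD expP_inj eta0 eta1 uE noroot out_eta
  expS_inj eta_gen hF odd_f.
apply/setP=> s; rewrite !inE;
  apply/forallP/existsP => [sP|[l /existsP[k /andP[l0 /forallP sE]]] x].
  have {}sP x y : adj F q0 u (s x) (s y) = adj F q0 u x y by apply/eqP/(forallP (sP x)).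
  have [|m m0 mP] := form (fun p => K' (s (K p))).
    split=> [|x y xy]; last by rewrite -adjE sP adjE !KK.
    by apply: inj_comp (can_inj KK') _; apply: inj_comp perm_inj (can_inj KK).
  (* Conjugation by [Psi l] scales first coordinates by [l^-1], hence the inverse of [m]. *)
  exists m^-1; apply/existsP; exists (s (K (kone F))); rewrite invr_eq0 m0.
  apply/forallP=> x; apply/eqP.
  have v y : val y = kmx q0 (K' y) by rewrite -{1}[y]KK'.
  rewrite !v kmxJ ?invr_eq0 // invrK -(kmxM expD); congr kmx.
  by rewrite -mP KK'.
apply/forallP=> y; apply/eqP.
have v z : val z = kmx q0 (K' z) by rewrite -{1}[z]KK'.
have sE' z : K' (s z) = kmul q0 (l^-1 * (K' z).1, l^-1 ^+ q0.+1 * (K' z).2) (K' k).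
  by apply: (@kmx_inj F q0); rewrite (kmxM expD) -kmxJ // -!v; apply/eqP.
rewrite !adjE !sE' (kadj_mulr char2 expD) /kadj !arc_dilate ?invr_eq0 //.
Qed.
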